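(* Let $E$ be a Banach space. Then: (i) if $p=1$, then the class of coarse $1$-limited sets in $E$ coincides with the class of $(1,\infty)$-limited sets; (ii) if $1<p<\infty$, then the class of coarse $p$-limited sets in $E$ coincides with the class of $p$-$(V^\ast)$ sets.
   Context: Banach spaces are over $\mathbb{F}\in\{\mathbb{R},\mathbb{C}\}$; $\omega=\{0,1,2,\dots\}$; $E'$ is the dual Banach space; subsets are non-empty. A subset $A$ of $E$ is coarse $p$-limited if $T(A)$ is relatively compact for every continuous linear map $T:E\to\ell_p$ ($1\le p<\infty$). $A$ is $(1,\infty)$-limited if $\sup_{a\in A}|\langle\chi_n,a\rangle|\to0$ for every sequence $\{\chi_n\}_{n\in\omega}$ in $E'$ such that $(\langle\chi_n,x\rangle)_n\in\ell_1$ for every $x\in E$. $A$ is a $p$-$(V^\ast)$ set if $\sup_{a\in A}|\langle\chi_n,a\rangle|\to0$ for every weakly $p$-summable sequence $\{\chi_n\}$ in the Banach space $E'$, i.e. every sequence such that $(\langle\eta,\chi_n\rangle)_n\in\ell_p$ for every $\eta\in E''$. *)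

(* Defs.v *)
From HB Require Import structures.
From mathcomp Require Import all_boot all_order all_algebra.
From mathcomp Require Import all_classical all_reals all_analysis.
From mathcomp Require Import complex.

Set Implicit Arguments.
Unset Strict Implicit.
Unset Printing Implicit Defensive.

Import Order.TTheory GRing.Theory Num.Theory.
Import numFieldNormedType.Exports.

Local Open Scope classical_set_scope.
Local Open Scope ring_scope.

Variant scalar_kind := RealScalars | ComplexScalars.

Definition scalar_field (R : realType) (F : scalar_kind) : numFieldType :=
  match F with
  | RealScalars => R
  | ComplexScalars => R[i]
  end.

(* Norms of normed modules over a numFieldType K take their values in K;     *)
(* [scalar_re] and [real_scalar] convert between K and the reals.            *)
Definition scalar_re (R : realType) (F : scalar_kind) :
    scalar_field R F -> R :=
  match F with
  | RealScalars => fun x => x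
  | ComplexScalars => fun x => complex.Re x
  end.

Definition real_scalar (R : realType) (F : scalar_kind) :
    R -> scalar_field R F :=
  match F with
  | RealScalars => fun x => x
  | ComplexScalars => fun x => real_complex R x
  end.

Definition modulus (R : realType) (F : scalar_kind)
    (a : scalar_field R F) : R := scalar_re `|a|.

Section scalar_theory.
Context {R : realType} {F : scalar_kind}.
Local Notation K := (scalar_field R F).

Lemma real_scalarK : cancel (@real_scalar R F) (@scalar_re R F).
Proof. by case: F. Qed.

Lemma scalar_reK (x : K) : 0 <= x -> real_scalar F (scalar_re x) = x.
Proof.
case: F x => //= -[a b]; rewrite lecE /= => /andP[/eqP/= b0 _].
by rewrite b0.
Qed.

Lemma real_scalarD (a b : R) :
  real_scalar F (a + b) = real_scalar F a + real_scalar F b.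
Proof. by case: F => //=; rewrite rmorphD. Qed.

Lemma real_scalarM (a b : R) :
  real_scalar F (a * b) = real_scalar F a * real_scalar F b.
Proof. by case: F => //=; rewrite rmorphM. Qed.

Lemma real_scalar0 : real_scalar F 0 = 0 :> K.
Proof. by case: F. Qed.

Lemma real_scalar1 : real_scalar F 1 = 1 :> K.
Proof. by case: F. Qed.

Lemma ler_real_scalar (a b : R) :
  (real_scalar F a <= real_scalar F b :> K) = (a <= b).
Proof. by case: F => //=; rewrite lecR. Qed.

Lemma modulusE (a : K) : real_scalar F (modulus a) = `|a|.
Proof. by rewrite scalar_reK. Qed.

Lemma modulus_ge0 (a : K) : 0 <= modulus a.
Proof. by rewrite -ler_real_scalar modulusE real_scalar0. Qed.

Lemma modulus0 : modulus (0 : K) = 0.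
Proof.
by apply: (can_inj real_scalarK); rewrite modulusE normr0 real_scalar0.
Qed.

Lemma modulus1 : modulus (1 : K) = 1.
Proof.
by apply: (can_inj real_scalarK); rewrite modulusE normr1 real_scalar1.
Qed.

Lemma modulus_eq0 (a : K) : modulus a = 0 -> a = 0.
Proof.
move=> /(congr1 (@real_scalar R F)).
by rewrite modulusE real_scalar0 => /eqP; rewrite normr_eq0 => /eqP.
Qed.

Lemma ler_modulusD (a b : K) : modulus (a + b) <= modulus a + modulus b.
Proof. by rewrite -ler_real_scalar real_scalarD !modulusE ler_normD. Qed.

Lemma modulusM (a b : K) : modulus (a * b) = modulus a * modulus b.
Proof.
by apply: (can_inj real_scalarK); rewrite real_scalarM !modulusE normrM.
Qed.

End scalar_theory.

(* The dual space: continuous linear functionals, with the operator norm.    *)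
Section dual.
Context {R : realType} {F : scalar_kind}.
Local Notation K := (scalar_field R F).
Variable E : normedModType K.

Definition continuous_functional : {pred (E -> K^o)} :=
  fun f => `[< linear f /\ continuous f >].

Lemma continuous_functionalP (f : E -> K^o) :
  reflect (linear f /\ continuous f) (f \in continuous_functional).
Proof. exact: asboolP. Qed.

Lemma continuous_functional_submod : submod_closed continuous_functional.
Proof.
split.
  apply/continuous_functionalP; split; last by move=> x; exact: cvg_cst.
  by move=> a x y /=; rewrite scaler0 addr0.
move=> a f g /continuous_functionalP[lf cf] /continuous_functionalP[lg cg].
apply/continuous_functionalP; split.
  move=> b x y; rewrite !fctE lf lg !scalerDr !scalerA (mulrC a b).
  by rewrite -!addrA; congr (_ + _); rewrite addrCA.
move=> x; apply: (@cvgD _ K^o); last exact: cg.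
by apply: cvgZr; exact: cf.
Qed.

HB.instance Definition _ :=
  GRing.isSubmodClosed.Build K (E -> K^o) continuous_functional
    continuous_functional_submod.

Record dual := Dual {
  dual_fun :> E -> K^o ;
  dual_funP : dual_fun \in continuous_functional }.

HB.instance Definition _ := [isSub for dual_fun].
HB.instance Definition _ := [Choice of dual by <:].
HB.instance Definition _ := [SubChoice_isSubLmodule of dual by <:].

Definition dual_norm (f : dual) : K :=
  real_scalar F (sup [set modulus (f x) | x in [set x : E | `|x| <= 1]]).

Lemma dual_linear (f : dual) : linear f.
Proof. by case/continuous_functionalP: (dual_funP f). Qed.

Lemma dual_continuous (f : dual) : continuous f.
Proof. by case/continuous_functionalP: (dual_funP f). Qed.

HB.instance Definition _ (f : dual) :=
  GRing.isLinear.Build K E K^o *:%R f (@dual_linear f).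

Let S (f : dual) := [set modulus (f x) | x in [set x : E | `|x| <= 1]].

Lemma dual_has_sup (f : dual) : has_sup (S f).
Proof.
split; first by exists (modulus (f 0)), 0 => //=; rewrite normr0.
have /linear_boundedP[M [Mreal fM]] :
    bounded_near (f : {linear E -> K^o}) (nbhs (0 : E)).
  exact/continuous_linear_bounded/dual_continuous.
have {}fM : forall x, `|f x| <= (`|M| + 1) * `|x|.
  by apply: fM; rewrite (le_lt_trans (real_ler_norm Mreal))// ltrDl.
exists (scalar_re (`|M| + 1)) => _ [x /= x1 <-].
rewrite -(@ler_real_scalar R F) modulusE scalar_reK ?addr_ge0//.
by rewrite (le_trans (fM x))// ler_piMr// addr_ge0.
Qed.

Lemma dual_ub (f : dual) (x : E) : `|x| <= 1 -> modulus (f x) <= sup (S f).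
Proof.
by move=> x1; apply: sup_upper_bound; [exact: dual_has_sup|exists x].
Qed.

Let dual_norm_ge0 (f : dual) : 0 <= sup (S f).
Proof. by rewrite (le_trans (modulus_ge0 (f 0)))// dual_ub ?normr0. Qed.

Lemma dual_norm_triangle (f g : dual) :
  dual_norm (f + g) <= dual_norm f + dual_norm g.
Proof.
rewrite /dual_norm -real_scalarD ler_real_scalar; apply: ge_sup.
  by case: (dual_has_sup (f + g)).
move=> _ [x /= x1 <-]; apply: (le_trans (ler_modulusD (f x) (g x))).
by apply: lerD; exact: dual_ub.
Qed.

Let dual_normZ_le (a : K) (f : dual) :
  sup (S (a *: f)) <= modulus a * sup (S f).
Proof.
apply: ge_sup; first by case: (dual_has_sup (a *: f)).
move=> _ [x /= x1 <-]; rewrite [X in modulus X](_ : _ = a * f x)//.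
by rewrite modulusM ler_wpM2l ?modulus_ge0// dual_ub.
Qed.

Lemma dual_normZ (a : K) (f : dual) : dual_norm (a *: f) = `|a| * dual_norm f.
Proof.
rewrite /dual_norm -modulusE -real_scalarM.
congr (real_scalar F _); apply/eqP; rewrite eq_le dual_normZ_le /=.
have [->|a0] := eqVneq a 0.
  by rewrite modulus0 mul0r (dual_norm_ge0 (0 *: f)).
have ma : modulus a * modulus a^-1 = 1.
  by rewrite -modulusM mulfV// modulus1.
have := dual_normZ_le a^-1 (a *: f); rewrite scalerA mulVf// scale1r.
move=> /(ler_wpM2l (modulus_ge0 a)) /le_trans; apply.
by rewrite mulrA ma mul1r.
Qed.

Lemma dual_norm_eq0 (f : dual) : dual_norm f = 0 -> f = 0.
Proof.
rewrite -(@real_scalar0 R F) => /(can_inj (@real_scalarK R F)) f0.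
apply/val_inj/funext => x; have [->|x0] := eqVneq x 0.
  exact: linear0.
have n0 : `|x| != 0 by rewrite normr_eq0.
have : modulus (f (`|x|^-1 *: x)) = 0.
  by apply/le_anti; rewrite modulus_ge0 andbT -f0 dual_ub ?normfZV.
move=> /modulus_eq0; rewrite linearZ /= => /eqP.
by rewrite scaler_eq0 invr_eq0 (negbTE n0) => /eqP.
Qed.

HB.instance Definition _ := Lmodule_isNormed.Build K dual
  dual_norm_triangle dual_normZ dual_norm_eq0.

End dual.

(* The space l_p over the scalar field, 1 <= p < +oo.                        *)
Section ellp.
Context {R : realType} {F : scalar_kind}.
Local Notation K := (scalar_field R F).

Definition p_norm (p : R) (u : nat -> K) : \bar R :=
  'N[@counting nat R]_p%:E [EFin \o (fun n => modulus (u n))].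

Definition p_summable (p : R) (u : nat -> K) : Prop := (p_norm p u < +oo)%E.

Lemma p_normE (p : R) (u : nat -> K) : 0 < p ->
  (p_norm p u = (\sum_(n <oo) (modulus (u n) `^ p)%:E) `^ p^-1)%E.
Proof.
move=> p0; rewrite /p_norm Lnorm_counting//; congr (poweR _ _).
by apply: eq_eseriesr => n _ /=; rewrite ger0_norm ?modulus_ge0.
Qed.

(* The hypothesis 1 <= p is a parameter of the predicate, and hence of the   *)
(* type ellp below, because the norm axioms depend on it.                    *)
Definition ellp_pred (p : R) of 1 <= p : {pred (nat -> K^o)} :=
  fun u => `[< p_summable p u >].

Variables (p : R) (p1 : 1 <= p).

Let p0 : 0 < p. Proof. exact: lt_le_trans p1. Qed.

Lemma ellp_predP (u : nat -> K^o) :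
  reflect (p_summable p u) (u \in ellp_pred p1).
Proof. exact: asboolP. Qed.

Let mN (f : nat -> R) : measurable_fun [set: nat] f.
Proof. by []. Qed.

Lemma p_normD (u v : nat -> K^o) :
  (p_norm p (u \+ v)%R <= p_norm p u + p_norm p v)%E.
Proof.
apply: le_trans (minkowski_EFin _ (mN _) (mN _) p1).
rewrite /p_norm !Lnorm_counting//; apply: gt0_ler_poweR.
- by rewrite invr_ge0 ltW.
- by rewrite in_itv /= leey andbT nneseries_ge0// => n _ _; exact: poweR_ge0.
- by rewrite in_itv /= leey andbT nneseries_ge0// => n _ _; exact: poweR_ge0.
apply: lee_nneseries => [n _ _|n _]; first exact: poweR_ge0.
rewrite /= lee_fin ge0_ler_powR ?nnegrE ?(ltW p0)//.
rewrite !ger0_norm ?addr_ge0 ?modulus_ge0//.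
exact: ler_modulusD.
Qed.

Lemma p_normZ (a : K) (u : nat -> K^o) :
  (p_norm p (a \*: u)%R = (modulus a)%:E * p_norm p u)%E.
Proof.
rewrite !p_normE//.
under eq_eseriesr do rewrite modulusM powRM ?modulus_ge0// EFinM.
rewrite nneseriesZl; last by move=> n _; rewrite lee_fin powR_ge0.
rewrite poweRM ?lee_fin ?powR_ge0//; last first.
  by apply: nneseries_ge0 => n _ _; rewrite lee_fin powR_ge0.
by rewrite poweR_EFin -powRrM mulfV ?gt_eqF// powRr1 ?modulus_ge0.
Qed.

Lemma ellp_submod : submod_closed (ellp_pred p1).
Proof.
split.
  apply/ellp_predP; rewrite /p_summable p_normE//.
  rewrite poweR_lty// eseries0// => n _ _.
  by rewrite modulus0 powR0// gt_eqF.
move=> a u v /ellp_predP us /ellp_predP vs; apply/ellp_predP.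
apply: (le_lt_trans (p_normD (a \*: (u : nat -> K^o)) v)).
by rewrite p_normZ lte_add_pinfty// lte_mul_pinfty ?lee_fin ?modulus_ge0.
Qed.

HB.instance Definition _ :=
  GRing.isSubmodClosed.Build K (nat -> K^o) (ellp_pred p1) ellp_submod.

Record ellp := Ellp {
  ellp_fun :> nat -> K^o ;
  ellp_funP : ellp_fun \in ellp_pred p1 }.

HB.instance Definition _ := [isSub for ellp_fun].
HB.instance Definition _ := [Choice of ellp by <:].
HB.instance Definition _ := [SubChoice_isSubLmodule of ellp by <:].

Definition ellp_norm (u : ellp) : K :=
  real_scalar F (fine (p_norm p u)).

Lemma p_norm_fin (u : ellp) : p_norm p u \is a fin_num.
Proof.
by rewrite ge0_fin_numE; [exact/ellp_predP/ellp_funP|exact: Lnorm_ge0].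
Qed.

Lemma ellp_norm_triangle (u v : ellp) :
  ellp_norm (u + v) <= ellp_norm u + ellp_norm v.
Proof.
rewrite /ellp_norm -real_scalarD ler_real_scalar -lee_fin EFinD !fineK ?p_norm_fin//.
exact: p_normD.
Qed.

Lemma ellp_normZ (a : K) (u : ellp) : ellp_norm (a *: u) = `|a| * ellp_norm u.
Proof.
rewrite /ellp_norm -modulusE -real_scalarM; congr (real_scalar F _).
by apply: EFin_inj; rewrite EFinM !fineK ?p_norm_fin//; exact: p_normZ.
Qed.

Lemma ellp_norm_eq0 (u : ellp) : ellp_norm u = 0 -> u = 0.
Proof.
rewrite -(@real_scalar0 R F) => /(can_inj (@real_scalarK R F)) u0.
have : p_norm p u = 0%E by rewrite -(fineK (p_norm_fin u)) u0.
have v0 n : (0 <= (modulus (u n) `^ p)%:E)%E by rewrite lee_fin powR_ge0.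
rewrite p_normE// => e.
have {e}s0 : (\sum_(n <oo) (modulus (u n) `^ p)%:E = 0)%E.
  by apply: poweR_eq0_eq0 e; apply: nneseries_ge0.
apply/val_inj/funext => n; apply: modulus_eq0.
have : ((modulus (u n) `^ p)%:E <= 0)%E.
  rewrite -s0 (nneseriesD1 (n := n))//.
  by rewrite leeDl//; apply: nneseries_ge0.
rewrite lee_fin => h; apply: (@powR_eq0_eq0 _ _ p).
by apply/le_anti; rewrite h powR_ge0.
Qed.

HB.instance Definition _ := Lmodule_isNormed.Build K ellp
  ellp_norm_triangle ellp_normZ ellp_norm_eq0.

End ellp.
Arguments ellp {R} F {p} p1.

Section limited_sets.
Context {R : realType} {F : scalar_kind}.
Local Notation K := (scalar_field R F).
Context {E : completeNormedModType K}.
Implicit Type A : set E.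

Definition coarse_limited (p : R) (p1 : 1 <= p) A : Prop :=
  forall T : {linear E -> ellp F p1},
    continuous T -> precompact (T @` A).

(* The supremum is taken in the extended reals, so that an unbounded family  *)
(* has supremum +oo.                                                         *)
Definition uniformly_null_on A (chi : nat -> dual E) : Prop :=
  ereal_sup [set (modulus (chi n a))%:E | a in A] @[n --> \oo] --> 0%E.

Definition one_infty_limited A : Prop :=
  forall chi : nat -> dual E,
    (forall x : E, p_summable 1 (fun n => chi n x)) -> uniformly_null_on A chi.

Definition weakly_p_summable (V : normedModType K) (p : R) (v : nat -> V) :
    Prop :=
  forall eta : dual V, p_summable p (fun n => eta (v n)).

Definition p_Vstar_set (p : R) A : Prop :=
  forall chi : nat -> dual E,
    weakly_p_summable p chi -> uniformly_null_on A chi.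

End limited_sets.

(* Main.v *)
Require Import Defs.
From HB Require Import structures.
From mathcomp Require Import all_boot all_order all_algebra.
From mathcomp Require Import all_classical all_reals all_analysis.
From mathcomp Require Import complex ring lra.

(** Both parts reduce to one characterization, valid for every 1 <= p: a set A is
    coarse p-limited if and only if every sequence chi in the dual of E that is
    p-summable at each point of E tends to 0 uniformly on A ([coarse_limitedP]).
    For p = 1 this is the definition of a (1,oo)-limited set. For p > 1 the
    definition of a p-V* set speaks instead of weakly p-summable chi, and these
    are the same sequences ([weakly_p_summableP]).

    The link between sequences and operators is the uniform boundedness principle
    ([uniform_boundedness]): if chi is p-summable at each point, then the p-norm
    of (chi_n x)_n is at most C |x|, so chi is the sequence of coordinates of a
    continuous operator from E to l_p. The same bound, dualized, makes chi weakly
    p-summable.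

    A subset of l_p is relatively compact as soon as its coordinates are bounded
    and its tails are uniformly small ([ellp_precompact]). If T maps A to a set
    with large tails, a gliding hump extracts disjoint blocks of coordinates, and
    norming combinations of the coordinates of T in these blocks
    ([norming_coefficients]) form a sequence that is p-summable at each point but
    does not tend to 0 uniformly on A.

    The coefficients that norm a finite block stand for the whole duality between
    l_p and its conjugate space: Minkowski's inequality, the bound needed for
    uniform boundedness, the passage to the bidual and the gliding hump all use
    them. *)

Set Implicit Arguments.
Unset Strict Implicit.
Unset Printing Implicit Defensive.

Import Order.TTheory GRing.Theory Num.Theory.
Import numFieldNormedType.Exports.

Local Open Scope classical_set_scope.
Local Open Scope ring_scope.

(** * Real-valued norms *)

Section real_norm.
Context {R : realType} {F : scalar_kind}.
Local Notation K := (scalar_field R F).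
Context {V : normedModType K}.
Implicit Types x y : V.

(** Norms of a normed module over K are elements of K; estimates are carried
    out in the ordered field R, so that both scalar fields are treated alike. *)
Definition rnorm x : R := scalar_re `|x|.

Lemma rnormE x : real_scalar F (rnorm x) = `|x|.
Proof. exact: scalar_reK. Qed.

Lemma rnorm_ge0 x : 0 <= rnorm x.
Proof. by rewrite -(@ler_real_scalar R F) real_scalar0 rnormE. Qed.

Lemma rnorm0 : rnorm 0 = 0.
Proof. by rewrite /rnorm normr0 -(@real_scalar0 R F) real_scalarK. Qed.

Lemma rnorm_gt0 x : x != 0 -> 0 < rnorm x.
Proof.
move=> x0; rewrite lt_neqAle rnorm_ge0 andbT eq_sym.
apply: contra x0 => /eqP r0; rewrite -normr_eq0 -rnormE r0.
by rewrite real_scalar0.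
Qed.

Lemma rnormD x y : rnorm (x + y) <= rnorm x + rnorm y.
Proof.
by rewrite -(@ler_real_scalar R F) real_scalarD !rnormE ler_normD.
Qed.

Lemma rnormN x : rnorm (- x) = rnorm x.
Proof. by rewrite /rnorm normrN. Qed.

Lemma rnormZ (a : K) x : rnorm (a *: x) = modulus a * rnorm x.
Proof.
apply: (can_inj (@real_scalarK R F)).
by rewrite real_scalarM !rnormE modulusE normrZ.
Qed.

Lemma ltr_real_scalar (a b : R) :
  (real_scalar F a < real_scalar F b :> K) = (a < b).
Proof.
rewrite !lt_neqAle ler_real_scalar; congr (~~ _ && _).
exact: (can_eq (@real_scalarK R F)).
Qed.

Lemma real_scalarN (a : R) : real_scalar F (- a) = - real_scalar F a.
Proof.
apply: (addIr (real_scalar F a)).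
by rewrite -real_scalarD !addNr real_scalar0.
Qed.

Lemma modulus_real (a : R) : modulus (real_scalar F a) = `|a|.
Proof.
have [a0|a0] := leP 0 a.
  have a0' : 0 <= real_scalar F a by rewrite -(@real_scalar0 R F) ler_real_scalar.
  by rewrite /modulus (ger0_norm a0') real_scalarK ger0_norm.
have a0' : real_scalar F a < 0 by rewrite -(@real_scalar0 R F) ltr_real_scalar.
by rewrite /modulus (ltr0_norm a0') -real_scalarN real_scalarK ltr0_norm.
Qed.

Lemma nbhs_rnormP x (A : set V) :
  nbhs x A <-> exists2 e : R, 0 < e & forall y, rnorm (x - y) < e -> A y.
Proof.
split.
  move=> /nbhs_normP[e /= e0 eA].
  have ee := scalar_reK (ltW e0).
  exists (scalar_re e); first by rewrite -ltr_real_scalar ee real_scalar0.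
  by move=> y; rewrite -ltr_real_scalar ee rnormE => /eA.
move=> [e e0 eA]; apply/nbhs_normP; exists (real_scalar F e) => /=.
  by rewrite -(@real_scalar0 R F) ltr_real_scalar.
by move=> y /=; rewrite -rnormE ltr_real_scalar; exact: eA.
Qed.

Lemma cvg_rnormP (G : set_system V) x : Filter G ->
  G --> x <-> forall e : R, 0 < e -> \forall y \near G, rnorm (x - y) < e.
Proof.
move=> FG; split=> [Gx e e0|Gx A].
  by apply: Gx; apply/nbhs_rnormP; exists e.
by move=> /nbhs_rnormP[e e0 eA]; apply: filterS eA (Gx e e0).
Qed.

End real_norm.

Lemma rnorm_modulus {R : realType} {F : scalar_kind}
  (a : (scalar_field R F)^o) : rnorm a = modulus a.
Proof. by []. Qed.

Section linear_maps.
Context {R : realType} {F : scalar_kind}.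
Local Notation K := (scalar_field R F).
Context {V W : normedModType K}.

Lemma continuous_rnormP (f : {linear V -> W}) :
  continuous f <-> exists C : R, forall x, rnorm (f x) <= C * rnorm x.
Proof.
split=> [cf|[C fC] x].
  have := cf 0; rewrite /continuous_at linear0 => /cvg_rnormP => /(_ 1 ltr01).
  move=> /nbhs_rnormP[e e0 ef]; exists (2 / e) => x.
  have [->|x0] := eqVneq x 0; first by rewrite linear0 !rnorm0 mulr0.
  have nx := rnorm_gt0 x0.
  have ge0 : 0 < e / 2 / rnorm x by rewrite !divr_gt0.
  have := ef (real_scalar F (e / 2 / rnorm x) *: x).
  rewrite /= !sub0r !rnormN linearZ_LR !rnormZ modulus_real gtr0_norm//.
  rewrite divfK ?gt_eqF// ltr_pdivrMr// mulr2n mulrDr mulr1 ltrDl e0.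
  move=> /(_ isT); rewrite -ltr_pdivlMl// mulr1 => /ltW /le_trans; apply.
  by rewrite !invfM !invrK mulrAC mulrC -mulrA (mulrC e^-1).
apply/cvg_rnormP => e e0.
have C0 : 0 < `|C| + 1 by rewrite ltr_wpDl.
apply/nbhs_rnormP; exists (e / (`|C| + 1)); first exact: divr_gt0.
move=> y; rewrite ltr_pdivlMr// => /(le_lt_trans _); apply.
rewrite -linearB (le_trans (fC _))// mulrC ler_wpM2l ?rnorm_ge0//.
by rewrite (le_trans (ler_norm C))// lerDl.
Qed.

End linear_maps.

(** * Finite blocks of sequences *)

Section block_norms.
Context {R : realType} {F : scalar_kind}.
Local Notation K := (scalar_field R F).
Variables (p : R) (p1 : 1 <= p).
Implicit Types (u y z : nat -> K) (m n : nat).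

Let p0 : 0 < p. Proof. exact: lt_le_trans p1. Qed.

(** All p-norms are taken over finite blocks of indices: a sequence is p-summable
    when its initial blocks are bounded, and the blocks themselves are what the
    gliding hump argument manipulates. *)
Definition psum u m n : R := \sum_(m <= i < n) modulus (u i) `^ p.

Definition pnorm u m n : R := psum u m n `^ p^-1.

Lemma psum_ge0 u m n : 0 <= psum u m n.
Proof. by apply: sumr_ge0 => i _; exact: powR_ge0. Qed.

Lemma pnorm_powR u m n : pnorm u m n `^ p = psum u m n.
Proof. by rewrite -powRrM mulVf ?gt_eqF// powRr1// psum_ge0. Qed.

Lemma le_psum u m n m' n' : (m' <= m)%N -> (n <= n')%N ->
  psum u m n <= psum u m' n'.
Proof.
move=> mm nn; have [nm|mn] := leqP n m.
  by rewrite /psum (big_geq nm) psum_ge0.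
have mn' : (m <= n)%N := ltnW mn.
rewrite /psum (big_cat_nat mm (leq_trans mn' nn))/= (big_cat_nat mn' nn)/=.
rewrite -[leLHS]add0r -[leLHS]addr0 -addrA.
by rewrite lerD ?psum_ge0// lerD2l psum_ge0.
Qed.

Lemma pnorm_le u m n (c : R) : 0 <= c ->
  pnorm u m n <= c <-> psum u m n <= c `^ p.
Proof.
move=> c0; split => h.
  by rewrite -pnorm_powR ge0_ler_powR// ?nnegrE ?powR_ge0// ltW.
rewrite (_ : c = (c `^ p) `^ p^-1); last first.
  by rewrite -powRrM mulfV ?gt_eqF// powRr1.
by rewrite ge0_ler_powR ?nnegrE ?invr_ge0 ?psum_ge0 ?powR_ge0// ltW.
Qed.

(* Young's inequality against the constant 1, valid down to p = 1. *)
Let young1 (t : R) : 0 <= t -> t <= t `^ p / p + (1 - p^-1).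
Proof.
move=> t0; have [->|p_neq1] := eqVneq p 1.
  by rewrite powRr1// invr1 mulr1 subrr addr0.
have p1' : 1 < p by rewrite lt_neqAle eq_sym p_neq1.
have q0 : 0 < 1 - p^-1 by rewrite subr_gt0 invf_lt1.
have := @conjugate_powR R t 1 p (1 - p^-1)^-1 t0 ler01 p0.
by rewrite invr_gt0 invrK powR1 !mul1r mulr1; apply => //; rewrite subrKC.
Qed.

Let powR_div (a b : R) : 0 <= a -> 0 <= b -> (a / b) `^ p = a `^ p / b `^ p.
Proof.
by move=> a0 b0; rewrite powRM ?invr_ge0// -powR_inv1// -powRrM mulN1r powRN.
Qed.

(** Finite-dimensional duality between l_p and its conjugate, with the conjugate
    norm of b expressed by its action on all z, so that no conjugate exponent
    appears and p = 1 is not special. The witness is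
    b_i = |y_i|^p / (y_i |y|^(p-1)), which is 0 when y_i = 0. The bound is
    Hoelder's inequality: with the weights w_i = |y_i|^p / |y|^p, of sum 1, it
    follows from Young's inequality applied to (|z_i| / |z|) / (|y_i| / |y|). *)
Lemma norming_coefficients y m n : exists b : nat -> K,
  \sum_(m <= i < n) b i * y i = real_scalar F (pnorm y m n) /\
  forall z, modulus (\sum_(m <= i < n) b i * z i) <= pnorm z m n.
Proof.
set S := psum y m n; set c := pnorm y m n.
have c0 : 0 <= c by exact: powR_ge0.
have S0 : 0 <= S by exact: psum_ge0.
have cS : c `^ p = S by exact: pnorm_powR.
exists (fun i => real_scalar F (modulus (y i) `^ p / S * c) / y i); split.
  transitivity (\sum_(m <= i < n) real_scalar F (modulus (y i) `^ p / S * c)).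
    apply: eq_bigr => i _.
    have [y0|y0] := eqVneq (y i) 0; last by rewrite divfK.
    by rewrite y0 modulus0 powR0 ?gt_eqF// !mul0r real_scalar0 !mul0r.
  transitivity (real_scalar F (\sum_(m <= i < n) modulus (y i) `^ p / S * c)).
    symmetry; apply: (big_morph _ (@real_scalarD R F) (@real_scalar0 R F)).
  congr (real_scalar F _); rewrite -mulr_suml -mulr_suml -/S.
  (* If S = 0 then c = 0 as well, and both sides vanish. *)
  have [s0|s0] := eqVneq S 0; last by rewrite -/(psum _ _ _) mulfV// mul1r.
  by rewrite /c /pnorm -/S s0 powR0 ?invr_eq0 ?gt_eqF// mulr0.
(* Replacing pnorm z by the larger d > 0 avoids dividing by 0 when z = 0. *)
move=> z; apply/ler_addgt0Pr => e e0; set d := _ + e.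
have d0 : 0 < d := ltr_wpDl (powR_ge0 _ _) e0.
have Zd : psum z m n <= d `^ p by apply/pnorm_le; [exact: ltW|rewrite lerDl ltW].
have [s0|s0] := eqVneq S 0.
  rewrite big1 ?modulus0 ?ltW// => i _.
  by rewrite s0 invr0 mulr0 mul0r real_scalar0 !mul0r.
have Sgt0 : 0 < S by rewrite lt_neqAle eq_sym s0.
have cgt0 : 0 < c by rewrite powR_gt0.
pose w i := modulus (y i) `^ p / S.
pose tau i := (modulus (z i) / d) / (modulus (y i) / c).
apply: (@le_trans _ _ (\sum_(m <= i < n) d * (w i * tau i))).
  apply: (@le_trans _ _ (\sum_(m <= i < n) modulus
     (real_scalar F (modulus (y i) `^ p / S * c) / y i * z i))).
    elim/big_ind2 : _ => [|a a' x x' ha hx|//]; first by rewrite modulus0.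
    exact: le_trans (ler_modulusD _ _) (lerD ha hx).
  apply: ler_sum => i _; rewrite !modulusM modulus_real ger0_norm; last first.
    by rewrite mulr_ge0// divr_ge0// powR_ge0.
  have -> : modulus (y i)^-1 = (modulus (y i))^-1.
    have [->|y0] := eqVneq (y i) 0; first by rewrite invr0 modulus0 invr0.
    have my0 : modulus (y i) != 0.
      by apply: contra y0 => /eqP /modulus_eq0 /eqP.
    by apply: (mulfI my0); rewrite -modulusM !mulfV// modulus1.
  rewrite /w /tau invfM invrK.
  rewrite [leRHS](_ : _ = modulus (y i) `^ p / S * c / modulus (y i) *
                          modulus (z i) * (d / d)).
    by rewrite divff ?gt_eqF// mulr1.
  by ring.
rewrite -mulr_sumr -[leRHS]mulr1 ler_pM2l//.
have w0 i : 0 <= w i by rewrite divr_ge0// powR_ge0.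
apply: (@le_trans _ _ (\sum_(m <= i < n)
    (modulus (z i) `^ p / d `^ p / p + w i * (1 - p^-1)))).
  apply: ler_sum => i _.
  apply: (@le_trans _ _ (w i * (tau i `^ p / p + (1 - p^-1)))).
    apply: ler_wpM2l => //; apply: young1.
    by rewrite !divr_ge0 ?modulus_ge0// ltW.
  rewrite mulrDr lerD2r mulrA ler_pM2r ?invr_gt0//.
  have [y0|y0] := eqVneq (y i) 0.
    by rewrite /w y0 modulus0 powR0 ?gt_eqF// !mul0r divr_ge0 ?powR_ge0.
  have my0 : 0 < modulus (y i).
    rewrite lt_neqAle modulus_ge0 andbT eq_sym.
    by apply: contra y0 => /eqP /modulus_eq0 /eqP.
  rewrite /w /tau !powR_div ?divr_ge0 ?modulus_ge0 ?(ltW d0) ?(ltW cgt0)// cS.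
  have yp0 : 0 < modulus (y i) `^ p by exact: powR_gt0.
  rewrite le_eqVlt; apply/orP; left; apply/eqP; field.
  by rewrite s0 !gt_eqF// powR_gt0.
rewrite big_split/= -!mulr_suml -/(psum z m n) -/(psum y m n) mulfV// mul1r.
have : psum z m n / d `^ p / p <= p^-1.
  by rewrite -[leRHS]mul1r ler_pM2r ?invr_gt0// ler_pdivrMr ?powR_gt0// mul1r.
lra.
Qed.

End block_norms.

(** * Summable sequences and the norm of l_p *)

Section summability.
Context {R : realType} {F : scalar_kind}.
Local Notation K := (scalar_field R F).
Variables (p : R) (p1 : 1 <= p).
Implicit Types (u : nat -> K).

Let p0 : 0 < p. Proof. exact: lt_le_trans p1. Qed.

Lemma pnorm1 u n : pnorm p u n n.+1 = modulus (u n).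
Proof.
by rewrite /pnorm /psum big_nat1 -powRrM mulfV ?gt_eqF// powRr1 ?modulus_ge0.
Qed.

Let total u : \bar R := (\sum_(n <oo) (modulus (u n) `^ p)%:E)%E.

Let psum_le_total u n : ((psum p u 0 n)%:E <= total u)%E.
Proof.
rewrite /psum -sumEFin; apply: nneseries_lim_ge => i _ _.
by rewrite lee_fin powR_ge0.
Qed.

Let total_le u (c : R) : (forall n, psum p u 0 n <= c) -> (total u <= c%:E)%E.
Proof.
move=> uc; apply: lime_le.
  by apply: is_cvg_nneseries => i _ _; rewrite lee_fin powR_ge0.
by apply: nearW => n; rewrite sumEFin lee_fin; exact: uc.
Qed.

Lemma p_norm_le u (c : R) : 0 <= c ->
  (p_norm p u <= c%:E)%E <-> forall n, pnorm p u 0 n <= c.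
Proof.
move=> c0; have t0 : (0 <= total u)%E.
  by apply: nneseries_ge0 => i _ _; rewrite lee_fin powR_ge0.
rewrite p_normE// -/(total u); split.
  move=> h n; move: h (psum_le_total u n); move: (total u) t0 => [t|//|//].
    rewrite !lee_fin => t0 tc ut.
    apply: le_trans tc; rewrite ge0_ler_powR ?nnegrE ?psum_ge0//.
    by rewrite invr_ge0 ltW.
  by rewrite poweRyr ?invr_eq0 ?gt_eqF// leNgt ltry.
move=> uc; have {uc} : (total u <= (c `^ p)%:E)%E.
  by apply: total_le => n; apply/(pnorm_le p1).
move: (total u) t0 => [t|//|//].
rewrite !lee_fin => t0 tc.
rewrite (_ : c = (c `^ p) `^ p^-1); last first.
  by rewrite -powRrM mulfV ?gt_eqF// powRr1.
by rewrite ge0_ler_powR ?nnegrE ?invr_ge0 ?powR_ge0// ltW.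
Qed.

Lemma p_summableP u :
  p_summable p u <-> exists c : R, forall n, pnorm p u 0 n <= c.
Proof.
split=> [us|[c uc]]; last first.
  have c0 : 0 <= c := le_trans (powR_ge0 _ _) (uc 0).
  by apply: (@le_lt_trans _ _ c%:E); [exact/p_norm_le|exact: ltry].
have uE : p_norm p u = (fine (p_norm p u))%:E.
  by rewrite fineK// ge0_fin_numE// Lnorm_ge0.
exists (fine (p_norm p u)); apply/p_norm_le; last by rewrite -uE.
by rewrite fine_ge0// Lnorm_ge0.
Qed.

Implicit Types v : ellp F p1.

Lemma rnorm_ellp v (c : R) : 0 <= c ->
  rnorm v <= c <-> forall n, pnorm p v 0 n <= c.
Proof.
move=> c0; rewrite -p_norm_le// /rnorm -[`|v|]/(ellp_norm v) real_scalarK.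
by rewrite -[X in _ <-> (X <= _)%E](fineK (p_norm_fin v)) lee_fin.
Qed.

Lemma pnorm_ellp v n : pnorm p v 0 n <= rnorm v.
Proof. by move: n; apply/rnorm_ellp; [exact: rnorm_ge0|]. Qed.

Lemma ellpD v v' n : (v + v') n = v n + v' n.
Proof. by []. Qed.

Lemma ellpB v v' n : (v - v') n = v n - v' n.
Proof. by []. Qed.

Lemma ellpZ (a : K) v n : (a *: v) n = a * v n.
Proof. by []. Qed.

Lemma modulus_ellp v n : modulus (v n) <= rnorm v.
Proof.
rewrite -pnorm1 (le_trans _ (pnorm_ellp v n.+1))//.
rewrite ge0_ler_powR ?nnegrE ?psum_ge0 ?invr_ge0 ?le_psum//.
exact: ltW.
Qed.

Lemma ellp_of u : p_summable p u -> exists v : ellp F p1, forall n, v n = u n.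
Proof. by move=> us; exists (Ellp (introT (ellp_predP p1 u) us)). Qed.

End summability.

Section block_norm_inequalities.
Context {R : realType} {F : scalar_kind}.
Local Notation K := (scalar_field R F).
Variables (p : R) (p1 : 1 <= p).
Implicit Types (u v : nat -> K).

Let p0 : 0 < p. Proof. exact: lt_le_trans p1. Qed.

Lemma eq_pnorm u v m n : (forall i, (m <= i < n)%N -> u i = v i) ->
  pnorm p u m n = pnorm p v m n.
Proof. by move=> uv; congr (_ `^ _); apply: eq_big_nat => i /uv ->. Qed.

(** Minkowski's inequality, read off from the coefficients norming u + v. *)
Lemma pnormD u v m n :
  pnorm p (fun i => u i + v i) m n <= pnorm p u m n + pnorm p v m n.
Proof.
have [b [bE ble]] := norming_coefficients p1 (fun i => u i + v i) m n.
rewrite -[leLHS]ger0_norm ?powR_ge0// -(@modulus_real R F) -bE.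
under eq_bigr do rewrite mulrDr.
by rewrite big_split (le_trans (ler_modulusD _ _))// lerD.
Qed.

Lemma pnormN u m n : pnorm p (fun i => - u i) m n = pnorm p u m n.
Proof.
by congr (_ `^ _); apply: eq_bigr => i _; rewrite /modulus normrN.
Qed.

Lemma psum_pnorm u v m n m' n' :
  psum p u m n <= psum p v m' n' -> pnorm p u m n <= pnorm p v m' n'.
Proof.
move=> uv; apply: ge0_ler_powR uv; rewrite ?nnegrE ?psum_ge0//.
by rewrite invr_ge0 ltW.
Qed.

Lemma le_pnorm u m n m' n' : (m' <= m)%N -> (n <= n')%N ->
  pnorm p u m n <= pnorm p u m' n'.
Proof. by move=> mm nn; apply/psum_pnorm/le_psum. Qed.

Lemma pnorm_cat u m k n : (m <= k)%N ->
  pnorm p u m n <= pnorm p u m k + pnorm p u k n.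
Proof.
move=> mk; have [nk|kn] := leqP n k.
  rewrite -[leLHS]addr0; apply: lerD; last exact: powR_ge0.
  exact: le_pnorm.
pose v i := if (i < k)%N then u i else 0.
pose w i := if (i < k)%N then 0 else u i.
have -> : pnorm p u m n = pnorm p (fun i => v i + w i) m n.
  by apply: eq_pnorm => i _; rewrite /v /w; case: ifP; rewrite (addr0, add0r).
apply: le_trans (pnormD _ _ _ _) _.
apply: lerD; apply: psum_pnorm; rewrite /psum (big_cat_nat mk (ltnW kn))/=.
  rewrite [X in _ + X](_ : _ = 0) ?addr0.
    by apply: ler_sum_nat => i /andP[_ ik]; rewrite /v ik.
  rewrite big_nat big1// => i /andP[ki _].
  by rewrite /v ltnNge ki modulus0 powR0 ?gt_eqF.
rewrite [X in X + _](_ : _ = 0) ?add0r.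
  by apply: ler_sum_nat => i /andP[ki _]; rewrite /w ltnNge ki.
rewrite big_nat big1// => i /andP[_ ik].
by rewrite /w ik modulus0 powR0 ?gt_eqF.
Qed.

Lemma pnorm_le_sum u n : pnorm p u 0 n <= \sum_(0 <= i < n) modulus (u i).
Proof.
elim: n => [|n ih].
  by rewrite /pnorm /psum !big_geq// powR0// invr_eq0 gt_eqF.
rewrite big_nat_recr//= (le_trans (pnorm_cat _ n.+1 (leq0n n)))// lerD//.
by rewrite pnorm1.
Qed.

Lemma modulus_cvg0 u : p_summable p u ->
  forall e : R, 0 < e -> \forall n \near \oo, modulus (u n) < e.
Proof.
move=> /(p_summableP p1)[c uc] e e0.
have ndu : nondecreasing_seq (psum p u 0).
  by move=> m n mn; exact: le_psum.
have /nondecreasing_is_cvgn : nondecreasing_seq (psum p u 0) by [].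
have ubu : has_ubound (range (psum p u 0)).
  exists (c `^ p) => _ [n _ <-]; apply/(pnorm_le p1) => //.
  exact: le_trans (powR_ge0 _ _) (uc 0).
move=> /(_ ubu) cu.
have : (modulus (u n) `^ p) @[n --> \oo] --> (0 : R).
  exact: cvg_series_cvg_0 cu.
move=> /cvgrPdist_lt /(_ _ (powR_gt0 p e0)); apply: filterS => n.
rewrite sub0r normrN ger0_norm ?powR_ge0// => h.
rewrite ltNge; apply: contraTN h => h; rewrite -leNgt.
by rewrite ge0_ler_powR ?nnegrE ?modulus_ge0// ltW.
Qed.

End block_norm_inequalities.

(** * Dual spaces *)

Section dual_norms.
Context {R : realType} {F : scalar_kind}.
Local Notation K := (scalar_field R F).
Context {V : normedModType K}.

Lemma modulus_dual (f : dual V) x : modulus (f x) <= rnorm f * rnorm x.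
Proof.
have [->|x0] := eqVneq x 0.
  by rewrite linear0 modulus0 rnorm0 mulr0.
have xgt0 := rnorm_gt0 x0.
have -> : rnorm f = sup [set modulus (f x) | x in [set x : V | `|x| <= 1]].
  exact: real_scalarK.
have := @dual_ub R F V f (real_scalar F (rnorm x)^-1 *: x).
rewrite linearZ_LR modulusM modulus_real gtr0_norm ?invr_gt0//.
rewrite ler_pdivrMl// mulrC; apply.
rewrite -(@real_scalar1 R F) -rnormE ler_real_scalar rnormZ modulus_real.
by rewrite gtr0_norm ?invr_gt0// mulVf// gt_eqF.
Qed.

Lemma rnorm_dual_le (f : dual V) (c : R) : 0 <= c ->
  (forall x, modulus (f x) <= c * rnorm x) -> rnorm f <= c.
Proof.
move=> c0 fc; rewrite /rnorm -[`|f|]/(dual_norm f) real_scalarK.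
apply: ge_sup; first by case: (dual_has_sup f).
move=> _ [x /= x1 <-]; rewrite (le_trans (fc x))// ler_piMr//.
by rewrite -(@ler_real_scalar R F) rnormE real_scalar1.
Qed.

Lemma dual_of (f : V -> K^o) (c : R) : linear f ->
  (forall x, modulus (f x) <= c * rnorm x) -> exists g : dual V, g =1 f.
Proof.
move=> lf fc; pose lin := GRing.isLinear.Build K V K^o *:%R f lf.
pose f' : {linear V -> K^o} := HB.pack f lin.
have cf : continuous f.
  by apply/(continuous_rnormP f'); exists c => x; exact: fc.
by exists (Dual (introT (continuous_functionalP f) (conj lf cf))).
Qed.

End dual_norms.

Lemma dual_eval {R : realType} {F : scalar_kind}
    (V : normedModType (scalar_field R F)) (x : V) :
  exists eta : dual (dual V), forall f : dual V, eta f = f x.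
Proof.
apply: (@dual_of _ _ (dual V) (fun f : dual V => f x) (rnorm x)).
  by [].
by move=> f; rewrite mulrC; exact: modulus_dual.
Qed.

(** * The uniform boundedness principle *)

Section uniform_boundedness.
Context {R : realType} {F : scalar_kind}.
Local Notation K := (scalar_field R F).

(** The operator norm c is described by what the uniform boundedness argument
    needs: it bounds T, and it is almost attained on the unit ball. *)
Lemma operator_norm {V W : normedModType K} (T : {linear V -> W}) :
  continuous T -> exists c : R,
    (forall x, rnorm (T x) <= c * rnorm x) /\
    (forall d, d < c -> exists2 u, rnorm u <= 1 & d < rnorm (T u)).
Proof.
move=> /continuous_rnormP[C TC].
pose S := [set rnorm (T x) | x in [set x : V | rnorm x <= 1]].
have supS : has_sup S.
  split; first by exists (rnorm (T 0)), 0 => //=; rewrite rnorm0.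
  exists `|C| => _ [x /= x1 <-]; rewrite (le_trans (TC x))//.
  rewrite (le_trans (ler_wpM2r (rnorm_ge0 x) (ler_norm C)))//.
  by rewrite ler_piMr.
exists (sup S); split=> [x|d dS].
  have [->|x0] := eqVneq x 0; first by rewrite linear0 !rnorm0 mulr0.
  have xgt0 := rnorm_gt0 x0.
  rewrite -ler_pdivrMr//; apply: sup_upper_bound => //.
  exists (real_scalar F (rnorm x)^-1 *: x) => /=.
    by rewrite rnormZ modulus_real gtr0_norm ?invr_gt0// mulVf// gt_eqF.
  by rewrite linearZ_LR rnormZ modulus_real gtr0_norm ?invr_gt0// mulrC.
have e0 : 0 < sup S - d by rewrite subr_gt0.
have [_ [u /= u1 <-]] := sup_adherent e0 supS.
by rewrite subKr; exists u.
Qed.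

Lemma geometric_cvg {V : completeNormedModType K} (x : nat -> V) :
  (forall k, rnorm (x k.+1 - x k) <= 3^-1 ^+ k) ->
  exists y, forall k, rnorm (y - x k.+1) <= 3^-1 ^+ k / 2.
Proof.
move=> xS; pose r k : R := 3^-1 ^+ k.
have rS k : r k.+1 = r k / 3 by rewrite /r exprS mulrC.
have r_gt0 k : 0 < r k by exact: exprn_gt0.
have xr k j : rnorm (x (k.+1 + j)%N - x k.+1) <= (r k - r (k + j)%N) / 2.
  elim: j => [|j ih]; first by rewrite !addn0 !subrr mul0r rnorm0.
  rewrite !addnS -(subrK (x (k.+1 + j)%N) (x (k.+1 + j).+1)) -addrA.
  apply: (le_trans (rnormD _ _)).
  have := xS (k.+1 + j)%N; rewrite -/(r _) addSn rS => h.
  move: ih h; move: (rnorm _) (rnorm _) => a b; lra.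
have xr2 k n : (k < n)%N -> rnorm (x n - x k.+1) <= r k / 2.
  move=> kn; rewrite -(subnKC kn) (le_trans (xr _ _))//.
  by rewrite ler_pM2r// gerBl ltW.
have /cvg_ex[y xy] : cvg (x @ \oo).
  apply: cauchy_cvg; apply: cauchy_exP => e e0.
  have ee := scalar_reK (ltW e0).
  have e'0 : 0 < scalar_re e by rewrite -(@ltr_real_scalar R F) ee real_scalar0.
  have [k ke] : exists k, r k < scalar_re e.
    have /cvgrPdist_lt /(_ _ e'0) : r k @[k --> \oo] --> (0 : R).
      by apply: cvg_expr; rewrite ger0_norm//; lra.
    move=> [N _ /(_ N (leqnn N))] /=; rewrite sub0r normrN gtr0_norm// => h.
    by exists N.
  exists (x k.+1); exists k.+1 => // n /= kn.
  rewrite -ball_normE /ball_ /= -rnormE -ee ltr_real_scalar -opprB rnormN.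
  by rewrite (le_lt_trans (xr2 _ _ kn))//; have := r_gt0 k; lra.
exists y => k; apply/ler_addgt0Pr => e e0.
move/cvg_rnormP : xy => /(_ _ e0)[N _ Nx].
have {}Nx := Nx (maxn N k.+1) (leq_maxl _ _).
have := xr2 k (maxn N k.+1) (leq_maxr _ _).
rewrite -(subrK (x (maxn N k.+1)) y) -addrA => h.
by rewrite (le_trans (rnormD _ _))// [leRHS]addrC lerD// ltW.
Qed.

(** Over R this is the Banach-Steinhaus theorem; here the scalars may also be
    complex. If the operator norms were unbounded, one could choose T_k of norm
    at least 6k 3^k and steps of length at most 3^-k, almost norming for T_k.
    For any x and v, one of T_k (x + v) and T_k (x - v) is at least as large as
    T_k v, so the sign of each step can be chosen to make T_k large at the new
    point. The later steps have total length at most 3^-k / 2, too short to undo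
    this, so the limit y has |T_k y| >= k for every k. *)
Theorem uniform_boundedness {V : completeNormedModType K}
    {W : normedModType K} {I : Type} (T : I -> {linear V -> W}) :
  (forall i, continuous (T i)) ->
  (forall x, exists C : R, forall i, rnorm (T i x) <= C) ->
  exists C : R, forall i x, rnorm (T i x) <= C * rnorm x.
Proof.
move=> cT Tbnd; apply: contrapT => /forallNP unbnd.
pose r k : R := 3^-1 ^+ k.
have r_gt0 k : 0 < r k by exact: exprn_gt0.
have step (kx : nat * V) : exists ix : I * V,
    rnorm (ix.2 - kx.2) <= r kx.1 /\
    forall y, rnorm (y - ix.2) <= r kx.1 / 2 -> kx.1%:R <= rnorm (T ix.1 y).
  move: kx => [k x] /=.
  have [i [z]] : exists i z, 6 * k%:R / r k * rnorm z < rnorm (T i z).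
    have := unbnd (6 * k%:R / r k); move=> /existsNP[i /existsNP[z /negP]].
    by rewrite -ltNge => h; exists i, z.
  have [c [Tc cT']] := operator_norm (cT i) => kz.
  have z0 : 0 < rnorm z.
    apply: rnorm_gt0; apply: contraTneq kz => ->.
    by rewrite linear0 !rnorm0 mulr0 ltxx.
  have kc : 6 * k%:R / r k < c.
    by rewrite -(ltr_pM2r z0) (lt_le_trans kz).
  have c0 : 0 < c by apply: le_lt_trans kc; rewrite divr_ge0// ltW.
  have [u u1 Tu] : exists2 u, rnorm u <= 1 & 2 / 3 * c < rnorm (T i u).
    by apply: cT'; lra.
  have [x' [xx Tx]] : exists x', rnorm (x' - x) <= r k /\
      r k * rnorm (T i u) <= rnorm (T i x').
    have rE : modulus (real_scalar F (r k)) = r k.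
      by rewrite modulus_real gtr0_norm.
    set v := real_scalar F (r k) *: u.
    have vr : rnorm v <= r k by rewrite rnormZ rE ler_piMr// ltW.
    have : 2 * (r k * rnorm (T i u)) <=
        rnorm (T i (x + v)) + rnorm (T i (x - v)).
      rewrite -{1}rE -rnormZ -linearZ_LR -/v.
      have -> : 2 * rnorm (T i v) = rnorm (T i v + T i v).
        rewrite -[T i v in RHS]scale1r -scalerDl -(@real_scalar1 R F).
        by rewrite -real_scalarD rnormZ modulus_real gtr0_norm.
      rewrite (_ : T i v + T i v = T i (x + v) - T i (x - v)); last first.
        have e : x + v - (x - v) = v + v by rewrite opprB addrC addrA subrK.
        by rewrite -linearB e linearD.
      by rewrite (le_trans (rnormD _ _))// rnormN.
    have [h _|h h2] := leP (r k * rnorm (T i u)) (rnorm (T i (x + v))).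
      by exists (x + v); split=> //; rewrite addrAC subrr add0r.
    exists (x - v); split; first by rewrite addrAC subrr add0r rnormN.
    lra.
  exists (i, x'); split=> //= y xy.
  have : rnorm (T i x') <= rnorm (T i y) + c * (r k / 2).
    rewrite -(subrK y x') linearD addrC (le_trans (rnormD _ _))// lerD2l.
    rewrite (le_trans (Tc _))// ler_pM2l// -opprB rnormN//.
  have : k%:R <= r k * c / 6.
    by move: kc; rewrite ltr_pdivrMr// => /ltW; lra.
  have : r k * (2 / 3 * c) <= r k * rnorm (T i u) by rewrite ler_pM2l// ltW.
  lra.
have [f fP] := choice step.
pose x := fix x k := if k is k'.+1 then (f (k', x k')).2 else 0.
have [y xy] : exists y, forall k, rnorm (y - x k.+1) <= r k / 2.
  by apply: geometric_cvg => k; have [] := fP (k, x k).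
have [C TC] := Tbnd y.
have := truncnS_gt C; apply/negP; rewrite -leNgt.
have [_ h] := fP ((Num.truncn C).+1, x (Num.truncn C).+1).
by apply: le_trans (h _ (xy _)) (TC _).
Qed.

End uniform_boundedness.

(** * Weak and pointwise summability in the dual *)

Section weak_summability.
Context {R : realType} {F : scalar_kind}.
Local Notation K := (scalar_field R F).
Variables (p : R) (p1 : 1 <= p).

Lemma dual_sumE {V : normedModType K} (b : nat -> K) (chi : nat -> dual V)
    m n x :
  (\sum_(m <= i < n) b i *: chi i) x = \sum_(m <= i < n) b i * chi i x.
Proof.
by apply: (big_morph (fun f : dual V => f x)).
Qed.

(** The closed graph property of the map sending x to (chi_n x)_n. Uniform
    boundedness is applied to the scalar functionals sum_(i < n) b_i chi_i, where
    b norms the first n values of chi at a point x: they are bounded at each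
    point by the p-norm of the values there, and the one built from x recovers
    this p-norm at x itself. *)
Lemma pointwise_p_summable_bounded {E : completeNormedModType K}
    (chi : nat -> dual E) :
  (forall x, p_summable p (fun n => chi n x)) ->
  exists C : R, forall x n, pnorm p (fun i => chi i x) 0 n <= C * rnorm x.
Proof.
move=> chis.
have [b bP] := choice (fun nx : nat * E =>
  norming_coefficients p1 (fun i => chi i nx.2) 0 nx.1).
pose g (nx : nat * E) : dual E := \sum_(0 <= i < nx.1) b nx i *: chi i.
have gE nx x : modulus (g nx x) <= pnorm p (fun i => chi i x) 0 nx.1.
  by rewrite dual_sumE; exact: (bP nx).2.
have [||C gC] := @uniform_boundedness R F E K^o (nat * E)%type
  (fun nx => g nx : {linear E -> K^o}).
- by move=> nx; exact: dual_continuous.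
- move=> x; have [c xc] := (p_summableP p1 _).1 (chis x).
  by exists c => nx; rewrite rnorm_modulus (le_trans (gE _ _)).
exists C => x n; rewrite (_ : pnorm _ _ _ _ = modulus (g (n, x) x)).
  exact: gC (n, x) x.
by rewrite dual_sumE (bP (n, x)).1 modulus_real ger0_norm// powR_ge0.
Qed.

(** In the dual of a Banach space, weak and weak* p-summability agree. A weak*
    p-summable chi satisfies |sum b_i chi_i| <= C whenever b lies in the unit
    ball of the conjugate space. Taking b to norm (eta (chi_i))_(i < n), the
    p-norm of these values is eta (sum b_i chi_i) <= C |eta|. *)
Lemma weakly_p_summableP {E : completeNormedModType K} (chi : nat -> dual E) :
  weakly_p_summable p chi <-> forall x, p_summable p (fun n => chi n x).
Proof.
split=> [chis x|/pointwise_p_summable_bounded[C chiC] eta].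
  have [eta etaE] := dual_eval x.
  by have := chis eta; under eq_fun do rewrite etaE.
apply/(p_summableP p1); exists (rnorm eta * `|C|) => n.
have [b [bE ble]] := norming_coefficients p1 (fun i => eta (chi i)) 0 n.
rewrite (_ : pnorm _ _ _ _ = modulus (eta (\sum_(0 <= i < n) b i *: chi i))).
  rewrite (le_trans (modulus_dual _ _))// ler_wpM2l ?rnorm_ge0//.
  apply: rnorm_dual_le => // x; rewrite dual_sumE.
  rewrite (le_trans (ble _))// (le_trans (chiC _ _))//.
  by rewrite ler_wpM2r ?rnorm_ge0// ler_norm.
rewrite linear_sum -[LHS]ger0_norm ?powR_ge0// -(@modulus_real R F).
by congr modulus; rewrite -[LHS]bE; apply: eq_bigr => i _; rewrite linearZ_LR.
Qed.
End weak_summability.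

(** * Compactness in l_p *)

Section scalar_compactness.
Context {R : realType} {T : Type}.
Variables (G : set_system T) (UG : UltraFilter G).

Let ultra_bounded_real (f : T -> R) (c : R) :
  (\forall t \near G, `|f t| <= c) ->
  exists l, forall e, 0 < e -> \forall t \near G, `|l - f t| < e.
Proof.
move=> fc; have PG : ProperFilter G by exact: ultra_proper.
have [l [_ lG]] : `[- c, c] `&` cluster (f @ G) !=set0.
  apply: segment_compact; apply: filterS fc => t.
  by rewrite /= in_itv/= -ler_norml.
exists l => e e0; have [//|Ge] := in_ultra_setVsetC [set t | `|l - f t| < e] UG.
have [x [nlx lx]] := lG [set x | ~ `|l - x| < e] [set x | `|l - x| < e] Ge
  (nbhsx_ballx l e e0).
by case: (nlx lx).
Qed.

(** Compactness of the closed disc, for both scalar fields, in the form used for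
    the coordinates of an ultrafilter on l_p. *)
Lemma ultra_bounded_scalar (F : scalar_kind) (f : T -> scalar_field R F)
    (c : R) :
  (\forall t \near G, modulus (f t) <= c) ->
  exists l, forall e, 0 < e -> \forall t \near G, modulus (l - f t) < e.
Proof.
case: F f => [|] f fc; first exact: (@ultra_bounded_real f c).
have Gre : \forall t \near G, `|complex.Re (f t)| <= c.
  apply: filterS fc => t; apply: le_trans.
  by have := normc_ge_Re (f t); rewrite lecE => /andP[].
have Gim : \forall t \near G, `|complex.Im (f t)| <= c.
  apply: filterS fc => t; apply: le_trans.
  rewrite /modulus /=; case: (f t) => a b /=.
  by rewrite -sqrtr_sqr ler_wsqrtr// lerDr sqr_ge0.
have [a Ga] := ultra_bounded_real Gre; have [b Gb] := ultra_bounded_real Gim.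
exists (Complex a b) => e e0; have e20 : 0 < e / 2 by rewrite divr_gt0.
apply: filterS2 (Ga _ e20) (Gb _ e20) => t; rewrite /modulus /=.
case: (f t) => x y /= ax bY.
apply: (@le_lt_trans _ _ (`|a - x| + `|b - y|)); last by lra.
have s0 : 0 <= `|a - x| + `|b - y| by rewrite addr_ge0.
rewrite -[leRHS](ger0_norm s0) -sqrtr_sqr; apply: ler_wsqrtr.
rewrite -(real_normK (num_real (a - x))) -(real_normK (num_real (b - y))).
by rewrite sqrrD addrAC lerDl mulrn_wge0// mulr_ge0.
Qed.

End scalar_compactness.

Section ellp_compactness.
Context {R : realType} {F : scalar_kind}.
Local Notation K := (scalar_field R F).
Variables (p : R) (p1 : 1 <= p).
Implicit Types (B : set (ellp F p1)) (u v : ellp F p1).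

Let p0 : 0 < p. Proof. exact: lt_le_trans p1. Qed.

(** For a single v the coordinates tend to 0, and |v_n - u_n| <= |v - u| makes
    this locally uniform; a compact set makes it uniform. *)
Lemma precompact_ellp_coord B : precompact B ->
  forall e : R, 0 < e -> \forall n \near \oo, forall v, B v -> modulus (v n) < e.
Proof.
move=> [C BC [cptC _]] e e0.
move/compact_near_coveringP : cptC.
move=> /(_ nat \oo (fun n (v : ellp F p1) => modulus (v n) < e) _).
have e20 : 0 < e / 2 by rewrite divr_gt0.
have h (u : ellp F p1) : C u -> \forall v \near u & n \near \oo,
    modulus ((v : ellp F p1) n) < e.
  move=> _; exists
    ([set v | rnorm (u - v) < e / 2], [set n | modulus (u n) < e / 2]).
    split=> /=; first by apply/nbhs_rnormP; exists (e / 2).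
    by apply: (modulus_cvg0 p1) => //; exact/ellp_predP/ellp_funP.
  move=> [v n] /= [uv un].
  have -> : v n = u n - (u - v) n by rewrite ellpB opprB addrC subrK.
  rewrite (le_lt_trans (ler_modulusD _ _))// /modulus normrN -!/(modulus _).
  by have := modulus_ellp (u - v) n; lra.
move=> /(_ h); apply: filterS => n Cn v Bv; exact/Cn/BC.
Qed.

(** B lies in the set C of sequences obeying the same bounds on coordinates and
    tails. An ultrafilter on C converges in each coordinate; the bounds pass to
    the coordinatewise limit, which is thus in l_p, and the uniform smallness of
    the tails turns coordinatewise convergence into convergence in norm. *)
Lemma ellp_precompact B :
  (forall n, exists c : R, forall v, B v -> modulus (v n) <= c) ->
  (forall e : R, 0 < e ->
    exists N, forall v, B v -> forall m, pnorm p v N m <= e) ->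
  precompact B.
Proof.
move=> /choice[c Bc] Btail.
have /choice[N BN] : forall e : R, exists N, 0 < e ->
    forall v, B v -> forall m, pnorm p v N m <= e.
  move=> e; have [e0|_] := ltP 0 e; last by exists 0%N.
  by have [M BM] := Btail e e0; exists M.
pose C := [set u : ellp F p1 | (forall n, modulus (u n) <= c n) /\
  forall e : R, 0 < e -> forall m, pnorm p u (N e) m <= e].
suff cptC : compact C.
  exists C; first by move=> v Bv; split=> [n|e e0 m]; [exact: Bc|exact: BN].
  by split=> //; apply: compact_closed => //; exact: norm_hausdorff.
rewrite compact_ultra => G UG GC.
have PG : ProperFilter G by exact: ultra_proper.
have /choice[l Gl] : forall n, exists l : K, forall e : R, 0 < e ->
    \forall u \near G, modulus (l - (u : ellp F p1) n) < e.
  move=> n; apply: (@ultra_bounded_scalar _ _ _ _ F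
    (fun u : ellp F p1 => u n) (c n)).
  by apply: filterS GC => u [].
have Glp m (e : R) : 0 < e -> \forall u \near G,
    pnorm p (fun i => l i - (u : ellp F p1) i) 0 m <= e.
  move=> e0; suff : \forall u \near G,
      \sum_(0 <= i < m) modulus (l i - (u : ellp F p1) i) <= e.
    by apply: filterS => u; apply: le_trans; exact: pnorm_le_sum.
  elim: m e e0 => [|m ih] e e0; first by apply: nearW => u; rewrite big_geq// ltW.
  have e20 : 0 < e / 2 by rewrite divr_gt0.
  apply: filterS2 (ih _ e20) (Gl m _ e20) => u h1 h2.
  by rewrite big_nat_recr//=; move: h1 h2; lra.
have lC n : modulus (l n) <= c n.
  apply/ler_addgt0Pr => e e0.
  have [u [[uc _] lu]] := filter_ex (filterI GC (Gl n e e0)).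
  rewrite -(subrK (u n) (l n)) addrC (le_trans (ler_modulusD _ _))//.
  by rewrite lerD// ltW.
have ltail (e : R) : 0 < e -> forall m, pnorm p l (N e) m <= e.
  move=> e0 m; apply/ler_addgt0Pr => d d0.
  have [u [[_ uN] lu]] := filter_ex (filterI GC (Glp m d d0)).
  rewrite (@eq_pnorm _ _ _ _ (fun i => u i + (l i - u i))); last first.
    by move=> i _; rewrite addrC subrK.
  rewrite (le_trans (pnormD p1 _ _ _ _))// lerD ?uN//.
  exact: le_trans (le_pnorm p1 _ (leq0n _) (leqnn m)) lu.
have [v vl] : exists v : ellp F p1, forall n, v n = l n.
  apply: (ellp_of p1); apply/(p_summableP p1).
  exists (pnorm p l 0 (N 1) + 1) => n.
  by rewrite (le_trans (pnorm_cat p1 _ n (leq0n (N 1))))// lerD2l ltail.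
have {vl}lv : l = v by apply/funext => n; rewrite vl.
move: lC ltail Glp; rewrite {}lv => vC vtail Gvp.
exists v; split; first by [].
apply/cvg_rnormP => e e0; have e40 : 0 < e / 4 by rewrite divr_gt0.
apply: filterS2 GC (Gvp (N (e / 4)) _ e40) => u [_ utail] uv.
apply: (@le_lt_trans _ _ (e / 4 + (e / 4 + e / 4))); last by lra.
apply/rnorm_ellp => [|n]; first by rewrite !addr_ge0// ltW.
apply: le_trans (pnorm_cat p1 _ n (leq0n (N (e / 4)))) _.
apply: lerD => //; apply: le_trans (pnormD p1 _ (fun i => - u i) _ _) _.
by rewrite pnormN lerD ?vtail ?utail.
Qed.

End ellp_compactness.

(** * Coarse limited sets *)

Section coarse_limited_sets.
Context {R : realType} {F : scalar_kind}.
Local Notation K := (scalar_field R F).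
Context {E : completeNormedModType K}.
Variables (p : R) (p1 : 1 <= p).
Implicit Types (A : set E) (chi : nat -> dual E).

Let p0 : 0 < p. Proof. exact: lt_le_trans p1. Qed.

Lemma uniformly_null_onP A chi : A !=set0 ->
  uniformly_null_on A chi <->
  forall e : R, 0 < e -> \forall n \near \oo, forall a, A a ->
    modulus (chi n a) <= e.
Proof.
move=> [a0 Aa0]; split=> [chi0 e e0|chi0 U].
  have : nbhs 0%E [set x : \bar R | (x < e%:E)%E].
    apply: open_nbhs_nbhs; split; first exact: open_ereal_lt_ereal.
    by rewrite /= lte_fin.
  move=> /chi0[M _ MU]; exists M => // n /MU /= sup_lt a Aa.
  rewrite -lee_fin (le_trans _ (ltW sup_lt))//.
  by apply: ereal_sup_ubound; exists a.
move=> U0; have /nbhs_ballP[e /= e0 eU] : nbhs (0 : R) [set r | U r%:E] by [].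
have e20 : 0 < e / 2 by rewrite divr_gt0.
have [M _ Mchi] := chi0 _ e20; exists M => // n /Mchi chin /=.
have : (ereal_sup [set (modulus (chi n a))%:E | a in A] <= (e / 2)%:E)%E.
  by apply: ge_ereal_sup => _ [a Aa <-]; rewrite lee_fin chin.
have : (0 <= ereal_sup [set (modulus (chi n a))%:E | a in A])%E.
  apply: (@le_trans _ _ (modulus (chi n a0))%:E).
    by rewrite lee_fin modulus_ge0.
  by apply: ereal_sup_ubound; exists a0.
case: (ereal_sup _) => [s|//|//]; rewrite !lee_fin => s0 se.
apply: eU; rewrite /ball/= sub0r normrN ger0_norm//; lra.
Qed.

Lemma operator_of_functionals chi :
  (forall x, p_summable p (fun n => chi n x)) ->
  exists2 T : {linear E -> ellp F p1},
    continuous T & forall x n, T x n = chi n x.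
Proof.
move=> chis; have [T TE] := choice (fun x => ellp_of p1 (chis x)).
have lT : linear T.
  move=> a x y; apply/val_inj/funext => n.
  by rewrite -[RHS]/(a * T x n + T y n) [LHS]TE !TE linearP.
pose lin := GRing.isLinear.Build K E (ellp F p1) *:%R T lT.
pose T' : {linear E -> ellp F p1} := HB.pack T lin.
exists T' => //; apply/continuous_rnormP.
have [C chiC] := pointwise_p_summable_bounded p1 chis.
exists `|C| => x; apply/rnorm_ellp => [|n].
  by rewrite mulr_ge0 ?rnorm_ge0.
rewrite (@eq_pnorm _ _ _ _ (fun i => chi i x)) => [|i _]; last exact: TE.
by rewrite (le_trans (chiC x n))// ler_wpM2r ?rnorm_ge0// ler_norm.
Qed.

Lemma functionals_of_operator (T : {linear E -> ellp F p1}) : continuous T ->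
  exists chi, forall n x, chi n x = T x n.
Proof.
move=> /continuous_rnormP[C TC].
have h n : exists f : dual E, forall x, f x = T x n.
  apply: (@dual_of _ _ E (fun x => T x n) C).
    by move=> a x y; rewrite linearP ellpD ellpZ.
  by move=> x; exact: le_trans (modulus_ellp _ _) (TC x).
by have [chi chiE] := choice h; exists chi.
Qed.

(** A need not be bounded a priori: the functionals 2^-n f are p-summable at each
    point, and a single one of them being bounded on A is enough. *)
Lemma uniformly_null_bounded A (f : dual E) : A !=set0 ->
  (forall chi, (forall x, p_summable p (fun n => chi n x)) ->
    uniformly_null_on A chi) ->
  exists c : R, forall a, A a -> modulus (f a) <= c.
Proof.
move=> A0 Anull; pose r n : R := 2^-1 ^+ n.
have r_gt0 n : 0 < r n by exact: exprn_gt0.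
pose chi n : dual E := real_scalar F (r n) *: f.
have chiE n x : modulus (chi n x) = r n * modulus (f x).
  rewrite (_ : chi n x = real_scalar F (r n) * f x)//.
  by rewrite modulusM modulus_real gtr0_norm.
have /Anull/(uniformly_null_onP _ A0)/(_ 1 ltr01)[n _ chin] :
    forall x, p_summable p (fun n => chi n x).
  move=> x; apply/(p_summableP p1); exists (2 * modulus (f x)) => n.
  apply: le_trans (pnorm_le_sum p1 _ n) _.
  suff -> : \sum_(0 <= i < n) modulus (chi i x) = (2 - 2 * r n) * modulus (f x).
    by rewrite ler_wpM2r ?modulus_ge0// gerBl mulr_ge0// ltW.
  elim: n => [|n ih]; first by rewrite big_geq// /r expr0 mulr1 subrr mul0r.
  by rewrite big_nat_recr//= ih chiE /r exprS; field.
exists (r n)^-1 => a Aa; have := chin n (leqnn n) a Aa.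
by rewrite chiE -ler_pdivlMl// mulr1.
Qed.

(** The sequences chi in question are the coordinate sequences of the operators
    T : E -> l_p, and compactness of T A forces the coordinates to tend to 0
    uniformly on A. Conversely, if T A had no uniformly small tails, there would
    be consecutive blocks of indices and points x_k of A such that T x_k has
    p-norm above e on the k-th block. Let psi_k be the combination of the
    coordinates of T in the k-th block that norms T x_k there. Then |psi_k y| is
    at most the p-norm of T y on this block; as the blocks are disjoint, psi is
    p-summable at each point, but psi_k x_k > e. *)
Theorem coarse_limitedP A : A !=set0 ->
  coarse_limited p1 A <->
  forall chi, (forall x, p_summable p (fun n => chi n x)) ->
    uniformly_null_on A chi.
Proof.
move=> A0; split=> [Acoarse chi chis|Anull T cT].
  have [T cT TE] := operator_of_functionals chis.
  apply/uniformly_null_onP => // e e0.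
  apply: filterS (precompact_ellp_coord (Acoarse T cT) e0) => n Tn a Aa.
  by rewrite -TE ltW// Tn//; exists a.
have [chi chiE] := functionals_of_operator cT.
apply: ellp_precompact => [n|].
  have [c fc] := uniformly_null_bounded (chi n) A0 Anull.
  by exists c => _ [a Aa <-]; rewrite -chiE fc.
move=> e e0; apply: contrapT => /forallNP notail.
have /choice[am amP] : forall N, exists am : E * nat,
    A am.1 /\ e < pnorm p (T am.1) N am.2.
  move=> N; have := notail N; move=> /existsNP[_ /not_implyP[[a Aa <-]]].
  by move=> /existsNP[m /negP]; rewrite -ltNge => h; exists (a, m).
(* The k-th block is [N k, N k.+1): am (N k) is a point whose tail from N k is
   large, with an index by which it has become large. *)
pose N := fix N k := if k is k'.+1 then (am (N k')).2 else 0%N.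
pose x k := (am (N k)).1.
have Ax k : A (x k) by have [] := amP (N k).
have Tx k : e < pnorm p (T (x k)) (N k) (N k.+1) by have [] := amP (N k).
(* An empty block has p-norm 0 and cannot exceed e. *)
have NS k : (N k <= N k.+1)%N.
  rewrite leqNgt; apply/negP => /ltnW h; move: (Tx k).
  rewrite /pnorm /psum big_geq// powR0 ?invr_eq0 ?gt_eqF// ltNge.
  by rewrite (ltW e0).
have [b bP] := choice (fun k =>
  norming_coefficients p1 (T (x k)) (N k) (N k.+1)).
pose psi k : dual E := \sum_(N k <= i < N k.+1) b k i *: chi i.
have psiE k y : psi k y = \sum_(N k <= i < N k.+1) b k i * T y i.
  by rewrite dual_sumE; apply: eq_bigr => i _; rewrite chiE.
have psi_le k y : modulus (psi k y) `^ p <= psum p (T y) (N k) (N k.+1).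
  rewrite -(pnorm_powR p1); apply: ge0_ler_powR; rewrite ?nnegrE ?powR_ge0//.
  - exact: ltW.
  - exact: modulus_ge0.
  - by rewrite psiE (bP k).2.
have psis y : p_summable p (fun k => psi k y).
  apply/(p_summableP p1); exists (rnorm (T y)) => n.
  apply: le_trans (pnorm_ellp (T y) (N n)).
  apply: (psum_pnorm p1); elim: n => [|n ih]; first by rewrite /psum !big_geq.
  rewrite /psum big_nat_recr//= (big_cat_nat (leq0n (N n)) (NS n))/=.
  exact: lerD ih (psi_le n y).
have [n _ psin] := (uniformly_null_onP _ A0).1 (Anull psi psis) e e0.
have := psin n (leqnn n) (x n) (Ax n); apply/negP; rewrite -ltNge psiE (bP n).1.
by rewrite modulus_real (lt_le_trans (Tx n))// ler_norm.
Qed.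

End coarse_limited_sets.

Theorem corollary5p19 (R : realType) (F : scalar_kind)
    (E : completeNormedModType (scalar_field R F)) :
  (forall A : set E, A !=set0 ->
     coarse_limited (lexx (1 : R)) A <-> one_infty_limited A) /\
  (forall (p : R) (p1 : 1 < p) (A : set E), A !=set0 ->
     coarse_limited (ltW p1) A <-> p_Vstar_set p A).
Proof.
split=> [A A0|p p1 A A0]; first exact: coarse_limitedP.
rewrite (coarse_limitedP (ltW p1) A0); split=> Anull chi chis; apply: Anull.
  exact/(weakly_p_summableP (ltW p1)).
exact/(weakly_p_summableP (ltW p1)).
Qed.
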